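(* Let $k\geq 1$. Any oblivious branching program computing MedianBit for $n$ inputs from $[2n]$ in time $T\le kn$ requires size at least $$2^{\tilde\Omega\left(n^{1/2^{4k+2}}\right)}.$$ In particular, there is a constant $c$ such that any oblivious branching program computing MedianBit for $n$ inputs from $[2n]$ that uses space $S$ requires time $$T\ge 0.25\,n\log\log_S n-c\,n.$$
   Context: $\log$ denotes $\log_2$; $[N]=\{1,\dots,N\}$; $\tilde\Omega$ hides (poly)logarithmic factors in $n$ (as well as constant factors). For $n$ input integers, the median is the middle element in sorted order (the $n/2$-th largest when $n$ is even), and MedianBit is the low order bit of the median. A branching program on $n$ inputs from a finite set $D$ (here $D=[2n]$) is a connected directed acyclic multigraph with a source node and possibly many sink nodes; each non-sink node is labeled by an input index in $[n]$ and has exactly one out-edge labeled by each element of $D$; each sink is labeled by an output value. On input $x\in D^n$, the computation starts at the source and at each node queries the input at the node's index and follows the edge labeled by its value, until a sink is reached, whose label is the output. Its size is its number of nodes, its space $S$ is $\log_2$ of its size, and its time $T$ is the length of the longest path from the source to a sink. It is oblivious if on every path from the source to a sink the sequence of input indices is precisely the same. *)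

(* Defs.v *)
From HB Require Import structures.
From mathcomp Require Import all_boot all_order all_algebra.
From mathcomp Require Import reals exp.

Set Implicit Arguments.
Unset Strict Implicit.
Unset Printing Implicit Defensive.

Import Order.TTheory GRing.Theory Num.Theory.

Section BranchingPrograms.

Variables (n : nat) (D : finType) (O : Type).

Variant instr (V : Type) : Type :=
  | Query of 'I_n & (D -> V)
  | Output of O.

Definition query_index V (s : instr V) : option 'I_n :=
  if s is Query i _ then Some i else None.

Definition edge_of (V : finType) (code : V -> instr V) : rel V :=
  fun u v => if code u is Query _ next then [exists d, next d == v] else false.

Record branching_program := BranchingProgram {
  node : finType;
  source : node;
  code : node -> instr node;
  source_in0 : forall v, ~~ edge_of code v source;
  bp_connected : forall u v,
    connect (fun a b => edge_of code a b || edge_of code b a) u v;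
  bp_acyclic : forall u v, edge_of code u v -> ~~ connect (edge_of code) v u
}.

Variable P : branching_program.

Definition edge : rel (node P) := edge_of (@code P).

Definition is_sink (v : node P) : bool := ~~ query_index (code v).

(* The path visits [source P :: p]; its length (number of edges) is [size p].
   Nothing requires that a single input follow it. *)
Definition source_sink_path (p : seq (node P)) : bool :=
  path edge (source P) p && is_sink (last (source P) p).

Definition queries (p : seq (node P)) : seq 'I_n :=
  pmap (fun v => query_index (code v)) (source P :: p).

Definition oblivious : Prop :=
  forall p q : seq (node P),
    source_sink_path p -> source_sink_path q -> queries p = queries q.

Definition bp_size : nat := #|node P|.

(* By acyclicity every path has fewer edges than the program has nodes, so
   bounding [m] by [bp_size] discards no path. *)
Definition bp_time : nat :=
  \max_(m < bp_size | [exists p : m.-tuple (node P), source_sink_path p]) m.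

Inductive evaluates (x : 'I_n -> D) : node P -> O -> Prop :=
  | EvalSink v o of code v = Output _ o : evaluates x v o
  | EvalStep v i next o of code v = Query i next & evaluates x (next (x i)) o :
      evaluates x v o.

Definition computes (f : ('I_n -> D) -> O) : Prop :=
  forall x, evaluates x (source P) (f x).

End BranchingPrograms.

(* [d : 'I_(2 * n)] encodes the integer [d.+1] of {1, ..., 2n}.  The list is
   sorted in decreasing order, so that position [n.-1./2] (counted from 0) is
   the n/2-th largest for n even and the middle one for n odd. *)
Definition median (n : nat) (x : 'I_n -> 'I_(2 * n)) : nat :=
  nth 0 (sort geq [seq (x i).+1 | i : 'I_n]) (n.-1)./2.

Definition median_bit (n : nat) (x : 'I_n -> 'I_(2 * n)) : bool :=
  odd (median x).

Local Open Scope ring_scope.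

Definition logb (R : realType) (b x : R) : R := ln x / ln b.

Definition log2 (R : realType) (x : R) : R := logb 2 x.

Definition bp_space (R : realType) n D O (P : @branching_program n D O) : R :=
  log2 (bp_size P)%:R.
Arguments bp_space R {n D O} P.

(* Main.v *)
(** In an oblivious program of length at most [k n], at least half of the inputs are
read at most [K <= 2 k] times.  Following Alon and Maass, among these there are two
disjoint sets [A] and [B] of at least about [n / 2^(4 k)] inputs such that the query
sequence splits into [r = 4 K + 1] consecutive blocks which avoid [B] and [A] in turn.
The program thus becomes an [r]-round protocol between a player holding the inputs in
[A] and one holding those in [B], a message being the node reached at the end of a block.
Such a protocol cannot follow [r] pointers down a tree of fan-out [t] when the player who
does not own the root speaks first, unless the number of messages is exponential in [t].
Pointer jumping embeds into the median of [(2 t - 1)^r] elements: the owner of a node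
pads the two ends of the interval of its values so that the median falls into the chosen
subtree.  As [2^(4 k + 2)] exceeds a suitable linear function of [K], [t] may be taken
to be the floor of [n^(1 / 2^(4 k + 2))], with no loss of logarithmic factors. *)

Require Import Defs.
From HB Require Import structures.
From mathcomp Require Import all_boot all_order all_algebra.
From mathcomp Require Import reals exp.
From mathcomp Require Import zify ring lra.
Import Order.TTheory GRing.Theory Num.Theory.

(** * Alternating blocks in sequences *)

(** Blocks may be empty, so both the set avoided by the first block and the number of blocks can be
    prescribed. *)
Fixpoint alternates {I : finType} r (A B : {set I}) (s : seq I) : Prop :=
  if r is r'.+1 then
    exists s1 s2, [/\ s = s1 ++ s2, ~~ has (mem B) s1 & alternates r' B A s2]
  else s = [::].

Lemma alternates_nil (I : finType) r (A B : {set I}) : alternates r A B [::].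
Proof. by elim: r A B => //= r IHr A B; exists [::], [::]. Qed.

(** Hence, when one set is first half read, the other one, still below half before this query, keeps
    half of its elements unread. *)
Lemma card_mem_take (I : finType) (A : {set I}) (s : seq I) l :
  #|[set i in A | i \in take l.+1 s]| <= #|[set i in A | i \in take l s]|.+1.
Proof.
case: (ltnP l (size s)) => [lts | ges]; last first.
  by rewrite !take_oversize // (leq_trans ges).
case: s lts => // x s lts; rewrite (take_nth x) //.
set y := nth x _ l; rewrite -[in leqRHS]add1n -(cards1 y).
apply: leq_trans (leq_card_setU _ _); apply/subset_leq_card/subsetP => i.
by rewrite !inE mem_rcons inE => /andP[-> /orP[->|->]]; rewrite ?orbT.
Qed.

Lemma card_mem_notin (I : finType) (A : {set I}) (s : seq I) :
  #|A| = #|[set i in A | i \in s]| + #|[set i in A | i \notin s]|.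
Proof.
rewrite -(cardsID [set i | i \in s] A); congr (_ + _).
  by apply: eq_card => i; rewrite !inE andbC.
by apply: eq_card => i; rewrite !inE andbC.
Qed.

(* Cut [s] at the first moment when half of [A] or half of [B] has been read,
   keep the half that has been read and the half of the other set that has not:
   each cut uses up one occurrence of the elements of one of the sets. *)
Lemma alon_maass (I : finType) c m a b (s : seq I) (A B : {set I}) :
  0 < m -> a + b <= c -> m * 2 ^ c <= #|A| -> m * 2 ^ c <= #|B| ->
  {in A, forall i, count_mem i s <= a} -> {in B, forall i, count_mem i s <= b} ->
  exists A' B' : {set I}, [/\ A' \subset A, B' \subset B, m <= #|A'|, m <= #|B'|
    & alternates c.*2.+1 A' B' s].
Proof.
move=> m_gt0; elim: c a b s A B => [|c IHc] a b s A B leab leA leB cA cB.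
  exists A, B; split=> //; rewrite ?(leq_trans _ leA) ?(leq_trans _ leB) ?muln1 //.
  exists s, [::]; rewrite cats0; split=> //; apply/hasPn=> i i_s.
  apply/negP => /cB; have -> : b = 0 by lia.
  by rewrite leqNgt -has_count has_pred1 i_s.
have hM : m * 2 ^ c.+1 = m * 2 ^ c + m * 2 ^ c by rewrite expnS; lia.
have M_gt0 : 0 < m * 2 ^ c by rewrite muln_gt0 m_gt0 expn_gt0.
have leM : m <= m * 2 ^ c by rewrite -{1}[m]muln1 leq_mul2l expn_gt0 orbT.
set M := m * 2 ^ c in hM M_gt0 leM IHc; rewrite hM in leA leB.
have rest x y z : z = x + y -> M + M <= z -> x < M.+1 -> M <= y by lia.
pose f l (C : {set I}) := #|[set i in C | i \in take l s]|.
pose reached l := (M <= f l A) || (M <= f l B).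
have [/existsP[[l0 /= _] hl0]|/existsPn none] :=
  boolP [exists l : 'I_(size s).+1, reached l]; last first.
  exists [set i in A | i \notin s], [set i in B | i \notin s].
  have := none ord_max; rewrite /reached /f /= take_size negb_or -!ltnNge.
  have := card_mem_notin I A s; have := card_mem_notin I B s.
  move=> eB eA /andP[hA hB]; split.
  - by apply/subsetP=> i; rewrite inE => /andP[].
  - by apply/subsetP=> i; rewrite inE => /andP[].
  - exact: leq_trans leM (rest _ _ _ eA leA (ltnW hA)).
  - exact: leq_trans leM (rest _ _ _ eB leB (ltnW hB)).
  exists s, [::]; rewrite cats0; split=> //; last exact: (alternates_nil _ c.*2.+2).
  by apply/hasPn=> i i_s; rewrite /= !inE i_s andbF.
have exl : exists l, reached l by exists l0.
case: (ex_minnP exl) => -[|l] hl minl.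
  have f0 (C : {set I}) : f 0 C = 0.
    by apply/eqP; rewrite cards_eq0; apply/eqP/setP=> i; rewrite !inE take0 andbF.
  by move: hl; rewrite /reached !f0 leqNgt M_gt0.
have {minl} /norP[] : ~~ reached l by apply: contraL (ltnSn l); rewrite -leqNgt => /minl.
rewrite -!ltnNge => ltA ltB; set s1 := take l.+1 s; set s2 := drop l.+1 s.
have es : s = s1 ++ s2 by rewrite cat_take_drop.
have half (C C' : {set I}) d d' :
    M + M <= #|C'| -> M <= f l.+1 C -> f l C' < M ->
    {in C, forall i, count_mem i s <= d} -> {in C', forall i, count_mem i s <= d'} ->
    [/\ 0 < d, M <= #|[set i in C | i \in s1]|, M <= #|[set i in C' | i \notin s1]|,
       {in [set i in C | i \in s1], forall i, count_mem i s2 <= d.-1} &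
       {in [set i in C' | i \notin s1], forall i, count_mem i s2 <= d'}].
  move=> leC' leC ltC' cC cC'.
  have eC' := card_mem_notin I C' s1.
  have := card_mem_take I C' s l; rewrite -/s1 => lC'; rewrite /f -/s1 in leC ltC'.
  have dec i : i \in [set i in C | i \in s1] -> (count_mem i s2).+1 <= d.
    rewrite inE => /andP[iC i_s1]; apply: leq_trans (cC i iC).
    by rewrite es count_cat -add1n leq_add2r -has_count has_pred1.
  split=> //.
  - have /card_gt0P[i /dec] : 0 < #|[set i in C | i \in s1]| by lia.
    exact: leq_trans.
  - by apply: rest eC' leC' _; apply: leq_ltn_trans lC' _.
  - by move=> i /dec; lia.
  - move=> i; rewrite inE => /andP[iC' _]; apply: leq_trans (cC' i iC').
    by rewrite es count_cat leq_addl.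
have sub1 (C : {set I}) : [set i in C | i \in s1] \subset C.
  by apply/subsetP=> i; rewrite inE => /andP[].
have sub0 (C : {set I}) : [set i in C | i \notin s1] \subset C.
  by apply/subsetP=> i; rewrite inE => /andP[].
have avoid (C C' : {set I}) : C' \subset [set i in C | i \notin s1] -> ~~ has (mem C') s1.
  move=> /subsetP sC'; apply/hasPn=> i i_s1; apply/negP => /sC'.
  by rewrite inE i_s1 andbF.
(* If [A] is half read, [s1] avoids the kept part of [B]: it is the first block, followed by an
   empty one. Otherwise the first block is empty and [s1] is the second. A cut thus costs two
   blocks. *)
case/orP: hl => hl.
  have [a_gt0 lA lB cA' cB'] := half A B a b leB hl ltB cA cB.
  have leab' : a.-1 + b <= c by lia.
  have [A' [B' [sA sB mA mB alt]]] := IHc _ _ s2 _ _ leab' lA lB cA' cB'.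
  exists A', B'; split; rewrite ?(subset_trans sA) ?(subset_trans sB) //.
  exists s1, s2; split=> //; first exact: avoid sB.
  by exists [::], s2.
have [b_gt0 lB lA cB' cA'] := half B A b a leA hl ltA cB cA.
have leab' : a + b.-1 <= c by lia.
have [A' [B' [sA sB mA mB alt]]] := IHc _ _ s2 _ _ leab' lA lB cA' cB'.
exists A', B'; split; rewrite ?(subset_trans sA) ?(subset_trans sB) //.
exists [::], s; split=> //.
by exists s1, s2; split=> //; apply: avoid sA.
Qed.

(** * Pointer jumping *)

(* Solvability on the rectangle [X * Y] by [r] messages in [Q], sent alternately by the
   two players, after which the output is constant.  Each message cuts the rectangle;
   [Z] ranges over all subsets of a message class. *)
Fixpoint protocol (Q : Type) r {A B : finType} (X : {set A}) (Y : {set B})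
    (F : A -> B -> bool) : Prop :=
  if r is r'.+1 then
    exists c : A -> Q, forall (Z : {set A}),
      (exists q, {in Z, forall x, x \in X /\ c x = q}) ->
      protocol Q r' Y Z (fun y x => F x y)
  else exists o, {in X & Y, forall x y, F x y = o}.

(** The players translate their inputs by [f] and [g] and run the given protocol. The image of [Z]
    need not be a whole message class, which is why [protocol] quantifies over subsets of the
    classes. *)
Lemma protocol_preim (Q : Type) r (A B A' B' : finType) (X : {set A}) (Y : {set B})
    (X' : {set A'}) (Y' : {set B'}) (F : A -> B -> bool) (F' : A' -> B' -> bool)
    (f : A' -> A) (g : B' -> B) :
  {in X', forall x, f x \in X} -> {in Y', forall y, g y \in Y} ->
  {in X' & Y', forall x y, F (f x) (g y) = F' x y} ->
  protocol Q r X Y F -> protocol Q r X' Y' F'.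
Proof.
elim: r A B A' B' X Y X' Y' F F' f g => [|r IHr] A B A' B' X Y X' Y' F F' f g fX gY eF /=.
  by case=> o ho; exists o => x y xX yY; rewrite -eF // ho ?fX ?gY.
case=> c hc; exists (c \o f) => Z [q hZ].
have hZ' : exists q, {in f @: Z, forall x, x \in X /\ c x = q}.
  by exists q => _ /imsetP[x xZ ->]; have [/fX] := hZ x xZ.
apply: (IHr _ _ _ _ _ _ _ _ _ _ g f) (hc _ hZ') => //.
- by move=> x xZ; apply: imset_f.
- by move=> y x yY xZ; apply: eF => //; case: (hZ x xZ).
Qed.

(* Pointer jumping down a tree with fan-out [t] and [r] levels of pointers.  The first
   component is the input of the player who speaks first, the second that of the
   player who owns the root; these roles are exchanged from a level to the next. *)
Fixpoint tree t r : finType * finType :=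
  if r is r'.+1 then
    ({ffun 'I_t -> (tree t r').2} : finType,
     ('I_t * {ffun 'I_t -> (tree t r').1})%type : finType)
  else (unit : finType, bool : finType).

Fixpoint jump t r : (tree t r).1 -> (tree t r).2 -> bool :=
  match r with
  | 0 => fun _ b => b
  | r'.+1 => fun u v => jump t r' (v.2 v.1) (u v.1)
  end.

Lemma tree_inh t r : 0 < t -> (0 < #|(tree t r).1|) /\ (0 < #|(tree t r).2|).
Proof.
move=> t_gt0; elim: r => [|r [IH1 IH2]] /=; first by rewrite card_unit card_bool.
by rewrite card_prod !card_ffun !card_ord muln_gt0 t_gt0 !expn_gt0 IH1 IH2.
Qed.

Lemma pigeonhole_card (A Q : finType) (X : {set A}) (c : A -> Q) :
  0 < #|X| -> exists q, #|X| <= #|Q| * #|[set x in X | c x == q]|.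
Proof.
move=> X_gt0.
have [/existsP//|/existsPn small] :=
  boolP [exists q, #|X| <= #|Q| * #|[set x in X | c x == q]|].
have eX : #|X| = \sum_q #|[set x in X | c x == q]|.
  rewrite -sum1_card (partition_big c predT) //=; apply: eq_bigr => q _.
  by rewrite -sum1_card; apply: eq_bigl => x; rewrite !inE.
move: X_gt0 => /card_gt0P[x0 _].
have Q_gt0 : 0 < #|Q| by apply/card_gt0P; exists (c x0).
have : \sum_(q : Q) (#|Q| * #|[set x in X | c x == q]|).+1 <= \sum_(q : Q) #|X|.
  by apply: leq_sum => q _; rewrite ltnNge.
rewrite (eq_bigr (fun q => #|Q| * #|[set x in X | c x == q]| + 1)); last first.
  by move=> q _; rewrite addn1.
rewrite big_split /= -big_distrr /= -eX !sum_nat_const muln1.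
by rewrite -[leqRHS]addn0 leq_add2l leqNgt Q_gt0.
Qed.

Lemma card_proj_prod (I V : finType) (X : {set {ffun I -> V}}) :
  #|X| <= \prod_i #|[set (x : {ffun I -> V}) i | x in X]|.
Proof.
have -> : \prod_i #|[set (x : {ffun I -> V}) i | x in X]| =
    #|family (fun i => [set (x : {ffun I -> V}) i | x in X])|.
  by rewrite card_family foldrE big_image /=.
apply/subset_leq_card/subsetP => x xX; apply/familyP=> i.
exact: imset_f.
Qed.

Lemma card_proj (I V : finType) (X : {set {ffun I -> V}}) i :
  #|X| * #|V| <= #|[set (x : {ffun I -> V}) i | x in X]| * #|V| ^ #|I|.
Proof.
apply: leq_trans (leq_mul (card_proj_prod _ _ X) (leqnn _)) _.
rewrite (bigD1 i) //= -mulnA leq_mul2l; apply/orP; right.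
have -> : #|V| ^ #|I| = \prod_(j : I) #|V| by rewrite prod_nat_const.
rewrite [leqRHS](bigD1 i) //= mulnC leq_mul2l; apply/orP; right.
by apply: leq_prod => j _; apply: max_card.
Qed.

(* A message cuts the density of [X] by a factor [#|Q|], so all but fewer than [s]
   of the [t] projections of the surviving set keep density 3/4. *)
Lemma jump_lower_bound (Q : finType) t s r
    (X : {set (tree t r).1}) (Y : {set (tree t r).2}) :
  0 < t -> s.*2 <= t -> 3 ^ s * (2 * #|Q|) < 4 ^ s ->
  #|(tree t r).1| <= 2 * #|X| -> 3 * #|(tree t r).2| <= 4 * #|Y| ->
  ~ protocol Q r X Y (jump t r).
Proof.
move=> t_gt0 le_s_t ltQ; elim: r X Y => [|r IHr] X Y dX dY.
  rewrite /= in dX dY *; case=> o ho.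
  have /card_gt0P[x xX] : 0 < #|X| by move: dX; rewrite card_unit; case: #|_|.
  have YT : Y = setT.
    apply/eqP; rewrite eqEcard subsetT cardsT card_bool.
    by move: dY; rewrite card_bool; case: #|_| => [|[|]].
  by have := ho x (~~ o) xX; rewrite YT inE => /(_ isT); case: (o).
have [] := tree_inh t r t_gt0; move: X Y dX dY IHr => /=.
set U := (tree t r).1; set V := (tree t r).2 => X Y dX dY IHr U_gt0 V_gt0 [c hc].
rewrite card_prod !card_ffun !card_ord in dX dY.
have X_gt0 : 0 < #|X|.
  by rewrite -(ltn_pmul2l (isT : 0 < 2)) muln0 (leq_trans _ dX) // expn_gt0 V_gt0.
have [q] := pigeonhole_card _ _ X c X_gt0; set Z := [set x in X | c x == q] => dZ.
have /hc{hc} prot : exists q, {in Z, forall x, x \in X /\ c x = q}.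
  by exists q => x; rewrite inE => /andP[? /eqP].
pose PZ i := [set (x : {ffun 'I_t -> V}) i | x in Z].
pose Bad := [set i | 4 * #|PZ i| < 3 * #|V|].
(* Otherwise [Z] would have density at most [(3/4)^s], while the pigeonhole leaves it at least
   [1 / (2 * #|Q|)]. *)
have lt_bad : #|Bad| < s.
  rewrite ltnNge; apply/negP => le_s.
  have : 4 ^ #|Bad| * #|Z| <= 3 ^ #|Bad| * #|V| ^ t.
    apply: leq_trans (leq_mul (leqnn _) (card_proj_prod _ _ Z)) _.
    rewrite -!prod_nat_const -[t in #|V| ^ t]card_ord -prod_nat_const.
    rewrite !(big_mkcond (fun i => i \in Bad)) -!big_split /=.
    apply: leq_prod => i _; case: ifP; rewrite ?inE ?mul1n => hi; first exact: ltnW.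
    exact: max_card.
  move=> h4.
  have h5 : 4 ^ #|Bad| * #|V| ^ t <= 3 ^ #|Bad| * (2 * #|Q|) * #|V| ^ t.
    have h : #|V| ^ t <= 2 * #|Q| * #|Z|.
      by rewrite -mulnA; apply: leq_trans dX _; rewrite leq_mul2l.
    apply: leq_trans (leq_mul (leqnn _) h) _.
    by rewrite mulnCA [leqRHS]mulnAC mulnC leq_mul2r h4 orbT.
  rewrite leq_pmul2r ?expn_gt0 ?V_gt0 // in h5.
  move: h5; rewrite -(subnK le_s) !expnD; set d := _ - s.
  have le34 : 3 ^ d <= 4 ^ d by case: (d) => // d'; rewrite leq_exp2r.
  have d_gt0 : 0 < 3 ^ d by rewrite expn_gt0.
  rewrite leqNgt -mulnA (@leq_trans (3 ^ d * 4 ^ s)) ?ltn_pmul2l //.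
  by rewrite leq_mul2r le34 orbT.
pose Yi i := [set w : {ffun 'I_t -> U} | (i, w) \in Y].
pose PY i := [set (x : {ffun 'I_t -> U}) i | x in Yi i].
have eY : #|Y| = \sum_i #|Yi i|.
  rewrite -sum1_card (partition_big (fun y => y.1) predT) //=.
  apply: eq_bigr => i _; rewrite -sum1_card.
  rewrite (reindex (fun w : {ffun 'I_t -> U} => (i, w))) /=; last first.
    exists snd => [[]//|[j w]]; rewrite inE /= => /andP[_ /eqP->] //.
  by apply: eq_bigl => w; rewrite !inE eqxx andbT.
(* Averaging: the slice [Yi i] is at most as dense as [PY i]. If this were below 1/2 for all [i]
   outside [Bad], [Y] would have density at most [(1 + #|Bad| / t) / 2 < 3/4], as
   [#|Bad| < s <= t / 2]. *)
have [i /andP[iBad iY]] : exists i, (i \notin Bad) && (#|U| <= 2 * #|PY i|).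
  have [/existsP//|/existsPn none] :=
    boolP [exists i, (i \notin Bad) && (#|U| <= 2 * #|PY i|)].
  have : 2 * #|Y| <= \sum_(i < t) (#|U| ^ t + (i \in Bad) * #|U| ^ t).
    rewrite eY big_distrr /=; apply: leq_sum => i _.
    have := card_proj _ _ (Yi i) i; rewrite card_ord -/(PY i) => hY.
    have := none i; rewrite negb_and negbK; case: (boolP (i \in Bad)) => /= _ hi.
      have : #|Yi i| <= #|U| ^ t by rewrite -[t in _ ^ t]card_ord -card_ffun max_card.
      by rewrite mul1n addnn -mul2n leq_mul2l.
    rewrite mul0n addn0 -(leq_pmul2r U_gt0) -mulnA (leq_trans (leq_mul (leqnn 2) hY)) //.
    by rewrite mulnA [leqRHS]mulnC leq_mul2r ltnW ?orbT // ltnNge.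
  rewrite big_split /= sum_nat_const card_ord -big_distrl /= -big_mkcond /= sum1_card.
  rewrite -mulnDl => h; have : 3 * t <= 2 * (t + #|Bad|).
    have h6 : 0 < #|U| ^ t by rewrite expn_gt0 U_gt0.
    rewrite -(leq_pmul2r h6) -!mulnA (leq_trans dY) //.
    by rewrite -[4]/(2 * 2) -mulnA leq_mul2l.
  by move: lt_bad le_s_t; move: #|Bad| => b; lia.
have iZ : 3 * #|V| <= 4 * #|PZ i| by rewrite inE -leqNgt in iBad.
have {IHr} [] := IHr [set w | w \in PY i] [set w | w \in PZ i].
- by rewrite cardsE.
- by rewrite cardsE.
(* Extensions of an input of subtree [i] to the whole tree; the defaults are reached only outside
   [PZ i] and [PY i]. *)
pose f (v : V) : {ffun 'I_t -> V} := odflt [ffun => v] [pick x in Z | x i == v].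
pose g (u : U) : {ffun 'I_t -> U} := odflt [ffun => u] [pick w in Yi i | w i == u].
have fP v : v \in PZ i -> f v \in Z /\ f v i = v.
  case/imsetP=> x xZ ->; rewrite /f; case: pickP => [y /andP[? /eqP]|/(_ x)] //=.
  by rewrite xZ eqxx.
have gP u : u \in PY i -> (i, g u) \in Y /\ g u i = u.
  case/imsetP=> x xZ ->; rewrite /g; case: pickP => [y /andP[+ /eqP]|/(_ x)] //=.
    by rewrite inE.
  by rewrite xZ eqxx.
apply: (protocol_preim Q r _ _ _ _ _ _ _ _ _ _ (fun u => (i, g u)) f) prot => [u|v|u v].
- by rewrite inE => /gP[].
- by rewrite inE => /fP[].
- by rewrite !inE /= => /gP[_ ->] /fP[_ ->].
Qed.

(** * Protocols from oblivious programs *)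

Definition node_step {n} {D : finType} {O} (P : branching_program n D O) (x : 'I_n -> D)
    (v : node P) : node P :=
  if code v is Query i next then next (x i) else v.

Fixpoint follows {n} {D : finType} {O} (P : branching_program n D O) (x : 'I_n -> D)
    (s : seq 'I_n) (v : node P) (o : O) : Prop :=
  match s, code v with
  | [::], Output o' => o' = o
  | i :: s', Query j next => j = i /\ follows P x s' (next (x i)) o
  | _, _ => False
  end.

Lemma follows_cat {n} {D : finType} {O} (P : branching_program n D O) x s1 s2 v o :
  follows P x (s1 ++ s2) v o -> follows P x s2 (iter (size s1) (node_step P x) v) o.
Proof.
elim: s1 v => //= i s1 IHs v; rewrite -iterS iterSr /node_step.
by case: (code v) => // j next [-> /IHs].
Qed.

Lemma iter_node_step_eq {n} {D : finType} {O} (P : branching_program n D O) x y s1 s2 v o :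
  {in s1, x =1 y} -> follows P x (s1 ++ s2) v o ->
  iter (size s1) (node_step P x) v = iter (size s1) (node_step P y) v.
Proof.
elim: s1 v => // i s1 IHs v exy; rewrite [size _]/= !iterSr /= {2 4}/node_step.
case: (code v) => // j next [-> fs]; rewrite -exy ?mem_head //.
by apply: IHs fs => k ks; apply: exy; rewrite inE ks orbT.
Qed.

(** While a block avoiding [J] is read, the nodes do not depend on [b], so the speaker finds the
    node at its end using an arbitrary [b0]. As [b0] may lie outside [Y], [iter_node_step_eq] asks
    [follows] of only one of its two inputs. *)
Lemma follows_protocol {n} {D : finType} (P : branching_program n D bool) r
    (A B : finType) (X : {set A}) (Y : {set B}) (F : A -> B -> bool)
    (inp : A -> B -> 'I_n -> D) (I J : {set 'I_n}) s v :
  0 < #|A| -> 0 < #|B| ->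
  (forall i, i \notin I -> forall a a' b, inp a b i = inp a' b i) ->
  (forall i, i \notin J -> forall a b b', inp a b i = inp a b' i) ->
  alternates r I J s ->
  {in X & Y, forall a b, follows P (inp a b) s v (F a b)} ->
  protocol (node P) r X Y F.
Proof.
elim: r A B X Y F inp I J s v => [|r IHr] A B X Y F inp I J s v A_gt0 B_gt0 dI dJ /=.
  move=> -> /= hv; case ev : (code v) hv => [i next|o] hv; last first.
    by exists o => a b aX bY; rewrite (hv a b).
  by exists true => a b aX bY; case: (hv a b).
case=> s1 [s2 [-> /hasPn avoid alt2]] hv.
have /card_gt0P[b0 _] := B_gt0.
exists (fun a => iter (size s1) (node_step P (inp a b0)) v) => Z [q hZ].
apply: (IHr _ _ _ _ _ (fun b a => inp a b) J I s2 q) => //.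
- by move=> i iJ b b' a; apply: dJ.
- by move=> i iI b a a'; apply: dI.
move=> b a bY aZ; have [aX <-] := hZ a aZ; have fab := hv a b aX bY.
rewrite -(@iter_node_step_eq _ _ _ P (inp a b) _ s1 s2 v (F a b)) //; last first.
  by move=> i /avoid iJ; apply: dJ.
exact: follows_cat fab.
Qed.

Lemma evaluates_path {n} {D : finType} {O} (P : branching_program n D O) x (v : node P) o :
  evaluates x v o -> exists p, [/\ path (@edge n D O P) v p, is_sink (last v p),
    size (pmap (fun v => query_index (code v)) (v :: p)) = size p &
    follows P x (pmap (fun v => query_index (code v)) (v :: p)) v o].
Proof.
elim=> {v o} [v o ev|v i next o ev _ [p [pv sp szp fp]]].
  by exists [::]; rewrite /= /is_sink ev; split; rewrite /= ?ev.
exists (next (x i) :: p); rewrite [pmap _ _]/= ev /=; split=> //.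
  by rewrite pv andbT /edge /edge_of ev; apply/existsP; exists (x i).
  by rewrite -szp.
by rewrite ev.
Qed.

Lemma path_size_lt {n} {D : finType} {O} (P : branching_program n D O) (v : node P) p :
  path (@edge n D O P) v p -> size p < bp_size P.
Proof.
move=> pv; have /card_uniqP e : uniq (v :: p).
  elim: p v pv => // w p IHp v /= /andP[vw pw]; have /= -> := IHp w pw; rewrite andbT.
  by apply: contra (bp_acyclic vw); apply: path_connect.
by rewrite -[size p < _]/(size (v :: p) <= _) -e max_card.
Qed.

Lemma oblivious_computes_follows {n} {D : finType} {O} (P : branching_program n D O)
    (f : (_ -> D) -> O) :
  oblivious P -> computes P f -> inhabited D ->
  exists s, size s <= bp_time P /\ forall x, follows P x s (source P) (f x).
Proof.
move=> obl cf [d].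
have [p0 [pp0 sp0 szp0 _]] := evaluates_path P (fun _ => d) _ _ (cf _).
have ssp0 : source_sink_path p0 by rewrite /source_sink_path pp0.
exists (queries p0); split=> [|x].
  rewrite /queries szp0 /bp_time.
  have lts := path_size_lt P _ _ pp0.
  apply: (@leq_trans (Ordinal lts)) => //.
  apply: (leq_bigmax_cond (F := fun m : 'I_(bp_size P) => val m)).
  by apply/existsP; exists (in_tuple p0).
have [p [pp sp szp fp]] := evaluates_path P x _ _ (cf x).
by rewrite (obl p0 p) // /source_sink_path pp.
Qed.

(** * Pointer jumping as a median *)

Lemma nth_sort_geq (s : seq nat) m i :
  count (fun y => m < y) s <= i -> i < count (fun y => m <= y) s ->
  nth 0 (sort geq s) i = m.
Proof.
move=> le_i lt_i.
have srt : sorted geq (sort geq s) by apply: sort_sorted => x y; exact: leq_total.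
have ep p : count p (sort geq s) = count p s.
  by apply/permP; rewrite perm_sort.
rewrite -!{}ep in le_i lt_i.
elim: {s} (sort geq s) i srt le_i lt_i => [|x s IHs] [|i] //= srt.
- case: (ltnP m x) => //= le_xm _; case: (leqP m x) => [|lt_xm]; first by lia.
  rewrite add0n -has_count => /hasP[y ys /= le_my].
  have /allP/(_ y ys) /= : all (geq x) s by apply: order_path_min srt => a b c /=; lia.
  by lia.
- move=> le_i lt_i; apply: IHs; first exact: path_sorted srt.
    case: ltnP le_i => //= le_xm _; rewrite (@eq_in_count _ _ pred0) ?count_pred0 //.
    have /allP h : all (geq x) s by apply: order_path_min srt => a b c /=; lia.
    by move=> y /h /=; lia.
  by move: lt_i; case: leqP => //= lt_xm; lia.
Qed.

(** Each end of an inner interval takes two values rather than one, so that all leaves start at an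
    offset of the same parity as the root's. *)
Fixpoint width t r := if r is r'.+1 then t * width t r' + 4 else 2.
(** The total number of elements: a level has [t] subtrees and padding worth [t - 1] more. *)
Definition weight t r := (t.*2.-1) ^ r.

Fixpoint sizes t r : nat * nat :=
  if r is r'.+1 then
    (t * (sizes t r').2, weight t r' * t.-1 + t * (sizes t r').1)
  else (0, 1).

(* The elements of the median instance encoding a pointer jumping instance, with
   values in [[off, off + width t r[].  The owner of the root pads both ends of the
   interval so that the median of the whole falls into the subtree pointed at. *)
Fixpoint vals t r off : ((tree t r).1 -> seq nat) * ((tree t r).2 -> seq nat) :=
  match r return ((tree t r).1 -> seq nat) * ((tree t r).2 -> seq nat) with
  | 0 => (fun _ => [::], fun b : bool => [:: off + b])
  | r'.+1 =>
    let child j := vals t r' (off + 2 + j * width t r') in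
    (fun u : (tree t r'.+1).1 => flatten [seq (child (val j)).2 (u j) | j <- enum 'I_t],
     fun v : (tree t r'.+1).2 => nseq (weight t r' * (t.-1 - v.1)) off
       ++ nseq (weight t r' * v.1) (off + 2 + t * width t r')
       ++ flatten [seq (child (val j)).1 (v.2 j) | j <- enum 'I_t])
  end.

Lemma size_vals t r off u v :
  size ((vals t r off).1 u) = (sizes t r).1 /\ size ((vals t r off).2 v) = (sizes t r).2.
Proof.
elim: r off u v => //= r IHr off u v; split.
  rewrite size_flatten /shape -map_comp sumnE big_map.
  under eq_bigr => j _ do rewrite /= (IHr _ (v.2 j) (u j)).2.
  by rewrite big_enum sum_nat_const card_ord.
rewrite !size_cat !size_nseq size_flatten /shape -map_comp sumnE big_map.
under eq_bigr => j _ do rewrite /= (IHr _ (v.2 j) (u j)).1.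
rewrite big_enum sum_nat_const card_ord addnA -mulnDr subnK //.
by case: v => -[i lt_i] w /=; lia.
Qed.

Lemma sizes_weight t r : 0 < t -> (sizes t r).1 + (sizes t r).2 = weight t r.
Proof.
move=> t_gt0; elim: r => //= r; rewrite {3}/weight expnS -/(weight t r).
case: (sizes t r) => a b /= <-; case: t t_gt0 => // t _.
by rewrite doubleS /= -!muln2; lia.
Qed.

Lemma odd_width t r : odd (width t r) = false.
Proof. by elim: r => //= r IHr; rewrite oddD oddM IHr andbF. Qed.

(** This makes the values fit below [2 * n] once [weight t r < n]. *)
Lemma width_le_weight t r : 2 < t -> width t r <= 2 * weight t r.
Proof.
move=> t_gt2; elim: r => //= r IHr; rewrite /weight expnS -/(weight t r).
have : 0 < weight t r by rewrite expn_gt0; lia.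
nia.
Qed.

Lemma vals_bounds t r off u v x :
  x \in (vals t r off).1 u ++ (vals t r off).2 v -> off <= x < off + width t r.
Proof.
elim: r off u v => [|r IHr] off u v.
  by rewrite /= inE => /eqP->; case: v; lia.
have hj (j : 'I_t) : (j < t)%N := ltn_ord j.
have sub j : x \in (vals t r (off + 2 + val j * width t r)).1 (v.2 j)
     ++ (vals t r (off + 2 + val j * width t r)).2 (u j) -> off <= x < off + width t r.+1.
  by move=> /IHr /=; have := hj j; nia.
rewrite !mem_cat => /or4P[] /=.
- case/flatten_mapP=> j _ xj; apply: (sub j); rewrite mem_cat xj orbT //.
- by rewrite mem_nseq => /andP[_ /eqP->]; nia.
- by rewrite mem_nseq => /andP[_ /eqP->]; nia.
- case/flatten_mapP=> j _ xj; apply: (sub j); rewrite mem_cat xj //.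
Qed.

Lemma sum_ltn_ord i t : \sum_(j < t) (j < i : nat) = minn i t.
Proof. by elim: t => [|t IHt]; rewrite ?big_ord0 ?big_ord_recr /= ?IHt; lia. Qed.

Lemma sum_gtn_ord i t : \sum_(j < t) (i < j : nat) = t.-1 - i.
Proof. by elim: t => [|t IHt]; rewrite ?big_ord0 ?big_ord_recr /= ?IHt; lia. Qed.

Lemma count_vals p t r off (u : (tree t r.+1).1) (v : (tree t r.+1).2) :
  let child (j : 'I_t) := vals t r (off + 2 + j * width t r) in
  count p ((vals t r.+1 off).1 u ++ (vals t r.+1 off).2 v) =
  p off * (weight t r * (t.-1 - v.1)) + p (off + 2 + t * width t r) * (weight t r * v.1)
  + \sum_j count p ((child j).1 (v.2 j) ++ (child j).2 (u j)).
Proof.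
move=> child; rewrite /= !count_cat !count_nseq !count_flatten !sumnE !big_map.
rewrite -!enumT !big_enum.
rewrite addnC -!addnA; congr (_ + (_ + _)); rewrite -big_split /=.
by apply: eq_bigr => j _; rewrite count_cat.
Qed.

(** Subtree [i] has [i] siblings below it and [t - 1 - i] above; the padding adds the weight of
    [t - 1 - i] subtrees below and of [i] above. The two sides balance, so the median of the subtree
    is that of the whole. *)
Lemma vals_median t r off u v : 0 < t -> exists m,
  [/\ off <= m < off + width t r, odd m = odd off (+) jump t r u v,
      (count (fun x => m < x) ((vals t r off).1 u ++ (vals t r off).2 v)).*2.+1
         = weight t r &
      (count (fun x => x < m) ((vals t r off).1 u ++ (vals t r off).2 v)).*2.+1
         = weight t r].
Proof.
move=> t_gt0; elim: r off u v => [|r IHr] off u v.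
  exists (off + v); rewrite /= !ltnn; split=> //; last by rewrite oddD oddb.
  by case: (v); lia.
case: v => i w.
have [m [bm om gm lm]] := IHr (off + 2 + i * width t r) (w i) (u i).
have lt_i := ltn_ord i.
pose L (j : 'I_t) := (vals t r (off + 2 + j * width t r)).1 (w j)
                     ++ (vals t r (off + 2 + j * width t r)).2 (u j).
have szL j : size (L j) = weight t r.
  have [e1 _] := size_vals t r (off + 2 + j * width t r) (w j) (u j).
  have [_ e2] := size_vals t r (off + 2 + j * width t r) (w j) (u j).
  by rewrite size_cat e1 e2 sizes_weight.
have before (j : 'I_t) x : j < i -> x \in L j -> x < m.
  by move=> lt_ji /vals_bounds xj; nia.
have after (j : 'I_t) x : i < j -> x \in L j -> m < x.
  by move=> lt_ij /vals_bounds xj; nia.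
have weightS : weight t r.+1 = t.*2.-1 * weight t r by rewrite /weight expnS.
exists m; split.
- by move: bm => /=; nia.
- by rewrite om /= !oddD oddM odd_width andbF !addbF.
- have e j : count (fun x => m < x) (L j) =
      (j == i) * count (fun x => m < x) (L i) + (i < j) * weight t r.
    case: (ltngtP j i) => [lt_ji|lt_ij|/val_inj->]; last by rewrite eqxx mul1n addn0.
      rewrite (eq_in_count (a2 := pred0)) ?count_pred0; last first.
        by move=> x /before-/(_ lt_ji) /=; lia.
      by rewrite -val_eqE /= (ltn_eqF lt_ji).
    rewrite -(szL j) (eq_in_count (a2 := predT)) ?count_predT; last first.
      by move=> x /after-/(_ lt_ij) /=; lia.
    by rewrite -val_eqE /= (gtn_eqF lt_ij) mul1n.
  rewrite count_vals /= -/(L _) (eq_bigr _ (fun j _ => e j)) big_split /=.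
  rewrite -!big_distrl /= sum_gtn_ord (bigD1 i) //= big1 ?addn0 ?eqxx ?mul1n; last first.
    by move=> j /negPf->.
  have -> : m < off = false by move: bm; nia.
  have -> : m < off + 2 + t * width t r by move: bm; nia.
  move: gm; rewrite -/(L i) weightS => gm; rewrite mul0n add0n mul1n.
  by move: (count _ _) gm => c gm; nia.
- have e j : count (fun x => x < m) (L j) =
      (j == i) * count (fun x => x < m) (L i) + (j < i) * weight t r.
    case: (ltngtP j i) => [lt_ji|lt_ij|/val_inj->]; last by rewrite eqxx mul1n addn0.
      rewrite -(szL j) (eq_in_count (a2 := predT)) ?count_predT; last first.
        by move=> x /before-/(_ lt_ji) /=; lia.
      by rewrite -val_eqE /= (ltn_eqF lt_ji) mul1n.
    rewrite (eq_in_count (a2 := pred0)) ?count_pred0; last first.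
      by move=> x /after-/(_ lt_ij) /=; lia.
    by rewrite -val_eqE /= (gtn_eqF lt_ij).
  rewrite count_vals /= -/(L _) (eq_bigr _ (fun j _ => e j)) big_split /=.
  rewrite -!big_distrl /= sum_ltn_ord (bigD1 i) //= big1 ?addn0 ?eqxx ?mul1n; last first.
    by move=> j /negPf->.
  have -> : off < m by move: bm; nia.
  have -> : off + 2 + t * width t r < m = false by move: bm; nia.
  move: lm; rewrite -/(L i) weightS => lm; rewrite mul0n addn0 mul1n (minn_idPl (ltnW lt_i)).
  by move: (count _ _) lm => c lm; nia.
Qed.

(* The values start at 1 because [median] shifts them by one, so that the parity of the
   median is the answer of the pointer jumping instance itself. *)
Lemma median_bit_jump n t r (A B : {set 'I_n}) :
  2 < t -> weight t r < n -> [disjoint A & B] ->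
  (sizes t r).1 <= #|A| -> (sizes t r).2 <= #|B| ->
  exists inp : (tree t r).1 -> (tree t r).2 -> 'I_n -> 'I_(2 * n),
  [/\ forall i, i \notin A -> forall u u' v, inp u v i = inp u' v i,
      forall i, i \notin B -> forall u v v', inp u v i = inp u v' i &
      forall u v, median_bit (inp u v) = jump t r u v].
Proof.
move=> t_gt2 lt_wn dAB leA leB; have t_gt0 : 0 < t by lia.
have d0 : 'I_(2 * n) by exists 0; lia.
pose pA := take (sizes t r).1 (enum A); pose pB := take (sizes t r).2 (enum B).
have szA : size pA = (sizes t r).1 by rewrite size_takel // -cardE.
have szB : size pB = (sizes t r).2 by rewrite size_takel // -cardE.
have pAA i : i \in pA -> i \in A by move/mem_take; rewrite mem_enum.
have pBB i : i \in pB -> i \in B by move/mem_take; rewrite mem_enum.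
pose rest := [seq i <- enum 'I_n | i \notin pA ++ pB]; pose p := pA ++ pB ++ rest.
have uniq_p : uniq p.
  rewrite /p catA cat_uniq cat_uniq !take_uniq ?enum_uniq // filter_uniq ?enum_uniq //=.
  rewrite !andbT; apply/andP; split; apply/hasPn=> i.
    by move/pBB=> iB; apply/negP => /pAA /(disjointFr dAB); rewrite iB.
  by rewrite mem_filter => /andP[].
have perm_p : perm_eq (enum 'I_n) p.
  apply: uniq_perm; rewrite ?enum_uniq // => i; rewrite mem_enum inE /p catA mem_cat.
  by rewrite mem_filter mem_enum inE andbT orbN.
have size_p : size p = n by rewrite -(perm_size perm_p) size_enum_ord.
(* The instance has [h] elements above its median; [hi] copies of the largest value raise this to
   the [(n.-1)./2] in the definition of [median]. The zeros lie below the instance, whose values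
   start at 1. *)
pose h := (weight t r).-1./2; pose hi := (n.-1)./2 - h.
pose fill := nseq hi (2 * n).-1 ++ nseq (n - weight t r - hi) 0.
pose full u v := (vals t r 1).1 u ++ (vals t r 1).2 v ++ fill.
pose inp u v (i : 'I_n) : 'I_(2 * n) := insubd d0 (nth 0 (full u v) (index i p)).
have szU u (v : (tree t r).2) : size ((vals t r 1).1 u) = size pA.
  by rewrite szA; case: (size_vals t r 1 u v).
have szV (u : (tree t r).1) v : size ((vals t r 1).2 v) = size pB.
  by rewrite szB; case: (size_vals t r 1 u v).
have notA u v i : i \notin A -> nth 0 (full u v) (index i p) =
    nth 0 ((vals t r 1).2 v ++ fill) (index i (pB ++ rest)).
  move=> iA; rewrite /p index_cat ifN ?(contra (@pAA i)) //.
  by rewrite /full [LHS]nth_cat (szU u v) ltnNge leq_addr addKn.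
exists inp; split=> [i iA u u' v|i iB u v v'|u v].
- by rewrite /inp !notA.
- rewrite /inp /full; congr insubd; rewrite /p index_cat; case: ifP => ipA.
    by rewrite !nth_cat !(szU u v) !index_mem ipA.
  rewrite !nth_cat !(szU u v) ltnNge leq_addr /= !addKn index_cat.
  have -> : i \in pB = false by apply: contraNF iB => /pBB.
  rewrite (szV u v) (szV u v') ltnNge leq_addr /=.
  by rewrite !addKn.
have [m [/andP[m_ge1 m_lt] om gm lm]] := vals_median t r 1 u v t_gt0.
have le_w := width_le_weight t r t_gt2.
have w_gt0 : 0 < weight t r by rewrite expn_gt0; lia.
have hE : h.*2.+1 = weight t r by rewrite /h -gm /= doubleK.
have h_le : h <= (n.-1)./2 by rewrite -hE in lt_wn; lia.
have hi_le : hi <= n - weight t r.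
  by rewrite /hi -hE; move: lt_wn; rewrite -hE; move: (h) => h'; lia.
have size_full : size (full u v) = n.
  rewrite /full catA !size_cat (szU u v) (szV u v) szA szB sizes_weight //.
  by rewrite !size_nseq [hi + _]subnKC // subnKC // ltnW.
have lt_full k : nth 0 (full u v) k < 2 * n.
  have [le_sk|lt_ks] := leqP (size (full u v)) k; first by rewrite nth_default //; lia.
  have := mem_nth 0 lt_ks; rewrite {2}/full catA mem_cat => /orP[|].
    move=> /vals_bounds/andP[_ lt_x]; apply: leq_trans lt_x _.
    by move: le_w lt_wn; move: (width t r) (weight t r) => a b; lia.
  by rewrite mem_cat !mem_nseq => /orP[] /andP[_ /eqP->]; move: lt_wn; clear; lia.
have perm_img : perm_eq [seq (inp u v i).+1 | i : 'I_n] [seq x.+1 | x <- full u v].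
  apply: (perm_trans (perm_map _ perm_p)).
  suff -> : [seq (inp u v i).+1 | i <- p] = [seq x.+1 | x <- full u v] by [].
  have i0 : 'I_n by exists 0; lia.
  apply: (@eq_from_nth _ 0); rewrite !size_map size_p ?size_full // => k lt_kn.
  rewrite (nth_map i0) ?size_p // (nth_map 0) ?size_full //.
  by rewrite /inp val_insubd index_uniq ?size_p // lt_full.
rewrite /median_bit /median (_ : nth 0 _ _ = m.+1) ?/= ?om ?negbK //.
have cnt a : count a [seq (inp u v i).+1 | i : 'I_n] =
    count (fun x => a x.+1) (full u v).
  by rewrite (permP perm_img) count_map; apply: eq_count.
have szL : size ((vals t r 1).1 u ++ (vals t r 1).2 v) = weight t r.
  by rewrite size_cat (szU u v) (szV u v) szA szB sizes_weight.
apply: nth_sort_geq; rewrite cnt /full catA count_cat.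
  have -> : count (fun x => m.+1 < x.+1) ((vals t r 1).1 u ++ (vals t r 1).2 v) = h.
    by rewrite /h -gm /= doubleK; apply: eq_count.
  rewrite count_cat !count_nseq /= mul0n addn0.
  by rewrite /hi; case: (_ < _); lia.
have -> : count (fun x => m < x.+1) ((vals t r 1).1 u ++ (vals t r 1).2 v) = h.+1.
  have := count_predC (fun x => x < m) ((vals t r 1).1 u ++ (vals t r 1).2 v).
  rewrite szL (@eq_count _ (predC _) (fun x => m < x.+1)); last first.
    by move=> x /=; rewrite -leqNgt.
  by move: (count _ _) (count _ _) lm => c1 c2; lia.
rewrite count_cat !count_nseq /= ltnS.
by rewrite (_ : m <= (2 * n).-1) ?mul1n /hi; lia.
Qed.

(** * Combining the reductions into a size bound *)

Lemma subset_of_card (T : finType) (A : {set T}) k :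
  k <= #|A| -> exists2 B : {set T}, B \subset A & #|B| = k.
Proof.
move=> le_k; exists [set x in take k (enum A)].
  by apply/subsetP=> x; rewrite inE => /mem_take; rewrite mem_enum.
by rewrite cardsE (card_uniqP (take_uniq _ (enum_uniq _))) size_takel // -cardE.
Qed.

(** Markov's inequality: each element outside the set takes at least [K + 1] places of [s]. *)
Lemma card_rare (T : finType) (s : seq T) K :
  2 * size s <= K.+1 * #|T| -> #|T| <= 2 * #|[set x | count_mem x s <= K]|.
Proof.
move=> le_s; set H := [set x | _]; have := cardsC H; set c := #|~: H| => eT.
suff : c * K.+1 <= size s by rewrite -eT in le_s *; nia.
apply: (@leq_trans (\sum_x count_mem x s)); last first.
  rewrite -sum1_size [leqRHS](partition_big id predT) //= leq_sum // => x _.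
  by rewrite sum1_count.
rewrite -sum_nat_const [leqRHS](bigID (mem (~: H))) /= (leq_trans _ (leq_addr _ _)) //.
by apply: leq_sum => x; rewrite !inE -ltnNge.
Qed.

(** The factor 4 pays for discarding the inputs read often and for splitting the others in two. With
    at most [K] occurrences in each part, [alon_maass] applies with [c = 2 K], whence [2 ^ (2 * K)]
    and [4 K + 1] blocks. *)
Lemma median_bit_size n (P : branching_program n 'I_(2 * n) bool) K t s :
  oblivious P -> computes P (@median_bit n) ->
  2 * bp_time P <= K.+1 * n -> 2 < t -> s.*2 <= t ->
  4 * weight t (4 * K).+1 * 2 ^ (2 * K) <= n ->
  4 ^ s <= 3 ^ s * (2 * bp_size P).
Proof.
move=> obl cP leT t_gt2 le_st le_n.
set r := (4 * K).+1 in le_n.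
have w_gt0 : 0 < weight t r by rewrite expn_gt0; lia.
have e_gt0 : 0 < 2 ^ (2 * K) by rewrite expn_gt0.
have d0 : 'I_(2 * n) by exists 0; nia.
have [q [leq fq]] := oblivious_computes_follows P _ obl cP (inhabits d0).
have leH : n <= 2 * #|[set i | count_mem i q <= K]|.
  rewrite -[n in n <= _]card_ord; apply: card_rare; rewrite card_ord.
  by apply: leq_trans leT; rewrite leq_mul2l.
set H := [set x | _] in leH.
have half M a : 4 * M <= n -> n <= 2 * a -> M + M <= a by lia.
have leHH := half (weight t r * 2 ^ (2 * K)) _ _ leH; rewrite mulnA in leHH.
have {half}leHH := leHH le_n.
have [A0 sA0 cA0] := subset_of_card _ H _ (leq_trans (leq_addr _ _) leHH).
have cB0 : weight t r * 2 ^ (2 * K) <= #|H :\: A0|.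
  by rewrite cardsD (setIidPr sA0) cA0 leq_subRL // (leq_trans (leq_addr _ _) leHH).
have occ (C : {set 'I_n}) : C \subset H -> {in C, forall i, count_mem i q <= K}.
  by move=> sC i /(subsetP sC); rewrite inE.
have [A [B [sA sB lA lB alt]]] := alon_maass _ (2 * K) _ K K q A0 (H :\: A0) w_gt0
  ltac:(lia) (eq_leq (esym cA0)) cB0 (occ _ sA0) (occ _ (subsetDl _ _)).
have dAB : [disjoint A & B].
  rewrite -setI_eq0; apply/eqP/setP=> i; rewrite !inE.
  by apply/negP => /andP[/(subsetP sA) iA /(subsetP sB)]; rewrite inE iA.
have wE := sizes_weight t r ltac:(lia).
have lt_wn : weight t r < n.
  by move: (weight t r) (2 ^ (2 * K)) w_gt0 e_gt0 le_n => w e; nia.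
have leA : (sizes t r).1 <= #|A| by apply: leq_trans lA; rewrite -wE leq_addr.
have leB : (sizes t r).2 <= #|B| by apply: leq_trans lB; rewrite -wE leq_addl.
have [inp [notA notB eqF]] := median_bit_jump n t r A B t_gt2 lt_wn dAB leA leB.
rewrite leqNgt; apply/negP => lts.
have [U_gt0 V_gt0] := tree_inh t r ltac:(lia).
apply: (jump_lower_bound (node P) t s r setT setT _ le_st lts).
- by lia.
- by rewrite cardsT leq_pmull.
- by rewrite cardsT leq_mul2r orbT.
apply: (follows_protocol P r _ _ _ _ _ inp A B q (source P) U_gt0 V_gt0 notA notB).
  by move: alt; rewrite -mul2n mulnA.
by move=> u v _ _; rewrite -eqF; apply: fq.
Qed.

(** * Size and time bounds *)

(** Covers the range where the exponent is at most 1. Constant inputs give both answers, so the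
    source is not a sink. *)
Lemma median_bit_size_gt1 n (P : branching_program n 'I_(2 * n) bool) :
  0 < n -> oblivious P -> computes P (@median_bit n) -> 1 < bp_size P.
Proof.
move=> n_gt0 obl cP.
have med (d : 'I_(2 * n)) : median_bit (fun _ : 'I_n => d) = odd d.+1.
  rewrite /median_bit /median (nth_sort_geq _ d.+1) //.
    by rewrite count_map (eq_count (a2 := pred0)) ?count_pred0 // => i; rewrite /= ltnn.
  rewrite count_map (eq_count (a2 := predT)) ?count_predT => [|i]; last by rewrite /= leqnn.
  by rewrite -cardE card_ord; lia.
have lt0 : 0 < 2 * n by lia.
have lt1 : 1 < 2 * n by lia.
have [s [_ fs]] := oblivious_computes_follows P _ obl cP (inhabits (Ordinal lt0)).
have := fs (fun _ => Ordinal lt0); have := fs (fun _ => Ordinal lt1); rewrite !med.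
case: s {fs} => [|i s] /=; case eS : (code (source P)) => [j next|o] //.
  by move=> ->.
move=> _ _; apply/card_gt1P; exists (source P), (next (Ordinal lt0)); split=> //.
apply/negP => /eqP e; have /negP[] := source_in0 (source P).
by rewrite /edge_of eS; apply/existsP; exists (Ordinal lt0); rewrite -e.
Qed.

Lemma median_bit_size_exp n (P : branching_program n 'I_(2 * n) bool) K t :
  oblivious P -> computes P (@median_bit n) ->
  2 * bp_time P <= K.+1 * n -> 1 < K -> 2 < t -> t ^ 4 ^ K.+1 <= n ->
  2 ^ (t %/ 6) <= 2 * bp_size P.
Proof.
move=> obl cP leT K_gt1 t_gt2 le_n; set j := t %/ 6.
(* With [s = 3 j] the bound gains a factor [(4/3)^3 = 64/27 > 2] for each unit of [j]. *)
have le_jt : (3 * j).*2 <= t by rewrite /j; lia.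
have : 4 ^ (3 * j) <= 3 ^ (3 * j) * (2 * bp_size P).
  apply: (median_bit_size _ _ _ _ _ obl cP leT t_gt2 le_jt).
  apply: leq_trans le_n.
  (* Bounding each 2 by [t] below leaves [2 + (4 K + 1) + 2 K] such factors, besides [4 K + 1]
     factors [t]. *)
  have leK : (10 * K).+4 <= 4 ^ K.+1.
    rewrite -(subnK K_gt1); elim: (K - 2) => // m IHm.
    by rewrite addSn expnS; move: (4 ^ _) IHm => e; lia.
  apply: leq_trans (leq_pexp2l (ltnW (ltnW t_gt2)) leK).
  have lew : weight t (4 * K).+1 <= (2 * t) ^ (4 * K).+1.
    by rewrite /weight leq_exp2r //; lia.
  apply: leq_trans (leq_mul (leq_mul (leqnn 4) lew) (leqnn _)) _.
  rewrite expnMn mulnA -[4]/(2 ^ 2) -expnD mulnAC -expnD.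
  apply: (@leq_trans (t ^ (2 + (4 * K).+1 + 2 * K) * t ^ (4 * K).+1)).
    by apply: leq_mul (leqnn _); rewrite leq_exp2r ?addnS // ltnW.
  by rewrite -expnD leq_pexp2l //; lia.
rewrite !expnM => h.
have : 2 ^ j * (3 ^ 3) ^ j <= (4 ^ 3) ^ j.
  by rewrite -expnMn; case: (j) => // j'; rewrite leq_exp2r.
move=> h2; have := leq_trans h2 h.
by rewrite mulnC leq_pmul2l // expn_gt0.
Qed.

Local Open Scope ring_scope.

Lemma median_bit_size_powR (R : realType) (k : R) (n : nat)
    (P : branching_program n 'I_(2 * n) bool) :
  1 <= k -> (0 < n)%N -> oblivious P -> computes P (@median_bit n) ->
  (bp_time P)%:R <= k * n%:R ->
  2 `^ (24^-1 * n%:R `^ (1 / 2 `^ (4 * k + 2))) <= (bp_size P)%:R :> R.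
Proof.
move=> k_ge1 n_gt0 obl cP leT; set E := 2 `^ (4 * k + 2); set y := n%:R `^ _.
have size_ge2 : 2 <= (bp_size P)%:R :> R.
  by rewrite (ler_nat R 2) median_bit_size_gt1.
have [le_y|gt_y] := lerP y 24.
  apply: le_trans size_ge2; apply: (@le_trans _ _ (2 `^ 1)); last by rewrite powRr1.
  by apply: ler_powR; lra.
(* [2 k < K + 1] gives the time condition, and [K <= 2 k] gives [4 ^ (K + 1) <= 2 ^ (4 k + 2)]. *)
pose K := Num.truncn (2 * k).
have /andP[leK gtK] : K%:R <= 2 * k < K.+1%:R by apply: truncn_itv; lra.
have K_gt1 : (1 < K)%N by rewrite truncn_ge_nat; lra.
have leT' : (2 * bp_time P <= K.+1 * n)%N.
  rewrite -(ler_nat R) !natrM (@le_trans _ _ (2 * (k * n%:R))) //.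
    by rewrite ler_pM2l //; lra.
  by rewrite mulrA ler_wpM2r // ltW.
pose t := Num.truncn y.
have y_ge0 : 0 <= y by lra.
have /andP[let_ gtt] := truncn_itv y_ge0; rewrite -/t in let_ gtt.
have E_gt0 : 0 < E by apply: powR_gt0.
have t_ge24 : (24 <= t)%N by rewrite truncn_ge_nat // ltW.
have le_tn : (t ^ 4 ^ K.+1 <= n)%N.
  rewrite -(ler_nat R) natrX.
  have -> : n%:R = y `^ E.
    by rewrite -powRrM mul1r mulVf ?gt_eqF // powRr1.
  rewrite -powR_mulrn //; apply: (@le_trans _ _ (y `^ (4 ^ K.+1)%:R)).
    by apply: ge0_ler_powR; rewrite ?nnegrE.
  apply: ler_powR; first by lra.
  rewrite natrX -[4%:R]/((2 * 2)%N%:R) natrM -expr2 -exprM -powR_mulrn //.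
  by apply: ler_powR; rewrite ?natrM -?natr1; lra.
have := median_bit_size_exp n P K t obl cP leT' K_gt1 _ le_tn.
move=> /(_ (leq_trans _ t_ge24))-/(_ isT); set j := (t %/ 6)%N => le_size.
have lt_tj : (t < 6 * j.+1)%N by rewrite /j; lia.
have le_yj : y <= 6 * j%:R + 6.
  apply: ltW (lt_le_trans gtt _); move: lt_tj.
  by rewrite -(ler_nat R) natrM -[j.+1%:R]natr1; lra.
have : 2 `^ j%:R <= 2 * (bp_size P)%:R :> R.
  by rewrite powR_mulrn // -natrX -natrM ler_nat.
(* The factor 2 before the size costs 1 in the exponent; as [j > 3],
   [y / 24 <= (j + 1) / 4 <= j - 1]. *)
have -> : j%:R = 1 + (j%:R - 1) :> R by lra.
rewrite powRD ?pnatr_eq0 ?implybT // powRr1 // ler_pM2l // => le2.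
apply: le_trans le2; apply: ler_powR; first by lra.
lra.
Qed.

Lemma space_time (R : realType) (n : nat) (P : branching_program n 'I_(2 * n) bool) :
  (0 < n)%N -> oblivious P -> computes P (@median_bit n) ->
  1 / 4 * n%:R * log2 (logb (bp_space R P) n%:R) - 5 / 2 * n%:R <= (bp_time P)%:R.
Proof.
move=> n_gt0 obl cP.
have N_gt0 : 0 < n%:R :> R by rewrite ltr0n.
have N_ge1 : 1 <= n%:R :> R by rewrite ler1n.
have ln2_gt0 : 0 < ln 2 :> R by apply: ln_gt0; lra.
have T_ge0 : 0 <= (bp_time P)%:R :> R by [].
(* The [+ 1] ensures [k >= 1]. The bound [4 k + 6] on the double logarithm yields [(k + 3/2) n], and
   removing [5/2 n] leaves [(k - 1) n], the time. *)
pose k : R := (bp_time P)%:R / n%:R + 1.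
have Tk : (bp_time P)%:R = (k - 1) * n%:R by rewrite /k; field; rewrite gt_eqF.
have k_ge1 : 1 <= k by rewrite lerDr divr_ge0.
suff le_log : log2 (logb (bp_space R P) n%:R) <= 4 * k + 6.
  rewrite Tk; nra.
have leT : (bp_time P)%:R <= k * n%:R by rewrite Tk ler_wpM2r // gerDl; lra.
have := median_bit_size_powR R k n P k_ge1 n_gt0 obl cP leT.
set S := bp_space R P; set E := 2 `^ (4 * k + 2); set y := n%:R `^ _ => le_size.
have E_gt0 : 0 < E by apply: powR_gt0.
(* The first case absorbs [S <= 1], where [logb S n%:R] is at most 0, division by zero being 0. *)
have [leL|gtL] := lerP (logb S n%:R) 1.
  apply: (@le_trans _ _ 0); last by lra.
  by rewrite /log2 /logb mulr_le0_ge0 ?invr_ge0 ?ln_le0 // ltW.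
have lnS_gt0 : 0 < ln S.
  rewrite ltNge; apply/negP => lnS_le0; move: gtL; apply/negP; rewrite -leNgt /logb.
  apply: (@le_trans _ _ 0) => //; rewrite mulr_ge0_le0 ?ln_ge0 // invr_le0 //.
have S_gt1 : 1 < S by rewrite ltNge; apply: contraL lnS_gt0 => /ln_le0; rewrite leNgt.
(* [S > 1] forces at least 3 nodes, and [log2 3 >= 3/2] because [2^3 <= 3^2]. *)
have S_ge : 3 / 2 <= S.
  have size_gt0 : 0 < (bp_size P)%:R :> R by apply: lt_le_trans le_size; apply: powR_gt0.
  have size_ge3 : (3 <= bp_size P)%N.
    rewrite ltnNge; apply: contraL S_gt1 => le2; rewrite -leNgt /S /bp_space /log2 /logb.
    by rewrite ler_pdivrMr // mul1r ler_ln ?posrE // (ler_nat R _ 2).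
  have : ln 3 <= ln (bp_size P)%:R :> R by rewrite ler_ln ?posrE // (ler_nat R 3).
  have : ln (2 ^+ 3) <= ln (3 ^+ 2) :> R by rewrite ler_ln ?posrE ?exprn_gt0 //; lra.
  rewrite !lnXn // /S /bp_space /log2 /logb ler_pdivlMr //; lra.
have y_gt0 : 0 < y by apply: powR_gt0.
(* The size bound gives [y <= 24 S], and [24 <= (3/2)^8 <= S^8]. Then [logb S n] is at most
   [9 E <= 16 E = 2 ^ (4 k + 6)]. *)
have le_yS : y <= S ^+ 9.
  have : y / 24 <= S.
    rewrite /S /bp_space /log2 /logb ler_pdivlMr //.
    have -> : y / 24 * ln 2 = ln (2 `^ (24^-1 * y)) by rewrite ln_powR [24^-1 * _]mulrC.
    by rewrite ler_ln ?posrE ?powR_gt0 // (lt_le_trans _ le_size) // powR_gt0.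
  have : (3 / 2) ^+ 8 <= S ^+ 8 by rewrite lerXn2r ?nnegrE //; lra.
  rewrite [S ^+ 9]exprS; have : 24 <= (3 / 2 : R) ^+ 8 by lra.
  move: (S ^+ 8) ((3 / 2 : R) ^+ 8) => a b; nra.
have ln_y : ln n%:R = E * ln y.
  by rewrite /y ln_powR mulrA mul1r mulfV ?mul1r // gt_eqF.
have leL : logb S n%:R <= 2 `^ (4 * k + 6).
  rewrite /logb ler_pdivrMr // ln_y.
  have -> : 2 `^ (4 * k + 6) = E * 2 ^+ 4.
    rewrite (_ : 4 * k + 6 = 4 * k + 2 + 4%:R); last by lra.
    by rewrite powRD ?pnatr_eq0 ?implybT // powR_mulrn.
  rewrite -mulrA ler_pM2l //.
  have : ln y <= ln (S ^+ 9) by rewrite ler_ln ?posrE ?exprn_gt0 //; lra.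
  by rewrite lnXn; lra.
rewrite /log2 {1}/logb ler_pdivrMr // -ln_powR ler_ln ?posrE ?powR_gt0 //.
by apply: lt_trans gtL.
Qed.

Theorem theorem6 (R : realType) :
  (exists (eps : R) (a n0 : nat), 0 < eps /\
     forall (k : R) (n : nat) (P : branching_program n 'I_(2 * n) bool),
       1 <= k -> (n0 <= n)%N ->
       oblivious P -> computes P (@median_bit n) ->
       (bp_time P)%:R <= k * n%:R ->
       2 `^ (eps * n%:R `^ (1 / 2 `^ (4 * k + 2)) / log2 n%:R ^+ a)
         <= (bp_size P)%:R :> R)
  /\
  (exists c : R,
     forall (n : nat) (P : branching_program n 'I_(2 * n) bool),
       (0 < n)%N ->
       oblivious P -> computes P (@median_bit n) ->
       1 / 4 * n%:R * log2 (logb (bp_space R P) n%:R) - c * n%:R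
         <= (bp_time P)%:R).
Proof.
split; last by exists (5 / 2) => n P; apply: space_time.
exists 24^-1, 0, 1; split=> [|k n P k_ge1 n_ge1 obl cP leT]; first by lra.
by rewrite expr0 divr1; apply: median_bit_size_powR.
Qed.
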